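(* There is an absolute constant $c>0$ such that for all positive integers $k\le N$ there exists a matrix $\mathbf{A}\in\mathbb{R}_{\ge0}^{N\times N}$ with non-negative rank $k$ satisfying $$\mathrm{perm}(\mathbf{A})\ge \exp\!\Big(c\,k\log\tfrac{N}{k}\Big)\,\mathrm{bethe}(\mathbf{A})\quad\text{and consequently}\quad \mathrm{perm}(\mathbf{A})\ge \exp\!\Big(c\,k\log\tfrac{N}{k}\Big)\,\mathrm{scaledsinkhorn}(\mathbf{A}).$$
   Context: The non-negative rank of $\mathbf{A}$ is the smallest $k$ with $\mathbf{A}=\sum_{j=1}^k\mathbf{v}_j\mathbf{u}_j^\top$, $\mathbf{v}_j,\mathbf{u}_j\ge0$. $\mathrm{perm}(\mathbf{A})=\sum_\sigma\prod_{x}\mathbf{A}_{x,\sigma(x)}$ over permutations $\sigma$. Let $\mathbf{K}_{rc}$ be the set of $N\times N$ doubly stochastic matrices; for $\mathbf{Q}\in\mathbf{K}_{rc}$, $\mathrm{U}(\mathbf{A},\mathbf{Q})=\sum_{x,y}\mathbf{Q}_{x,y}\log(\mathbf{A}_{x,y}/\mathbf{Q}_{x,y})$, $\mathrm{V}(\mathbf{Q})=\sum_{x,y}(1-\mathbf{Q}_{x,y})\log(1-\mathbf{Q}_{x,y})$ (conventions $0\log0=0$, $0\log(\cdot/0)=0$, $\log 0=-\infty$). $\mathrm{bethe}(\mathbf{A})=\max_{\mathbf{Q}\in\mathbf{K}_{rc}}\exp(\mathrm{U}(\mathbf{A},\mathbf{Q})+\mathrm{V}(\mathbf{Q}))$ and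 $\mathrm{scaledsinkhorn}(\mathbf{A})=\max_{\mathbf{Q}\in\mathbf{K}_{rc}}\exp(\mathrm{U}(\mathbf{A},\mathbf{Q})-N)$. *)

(* Defs.v *)
From HB Require Import structures.
From mathcomp Require Export all_boot all_order all_fingroup all_algebra.
From mathcomp Require Export all_classical all_reals all_analysis.
Set Implicit Arguments.
Unset Strict Implicit.
Unset Printing Implicit Defensive.
Import Order.TTheory GRing.Theory Num.Theory.
Local Open Scope classical_set_scope.
Local Open Scope ring_scope.

Definition nonneg_mx (R : realType) (m n : nat) (A : 'M[R]_(m, n)) : Prop :=
  forall i j, 0 <= A i j.

Definition nonneg_factorization (R : realType) (N k : nat) (A : 'M[R]_N) : Prop :=
  exists v u : 'I_k -> 'cV[R]_N,
    [/\ forall j, nonneg_mx (v j),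
        forall j, nonneg_mx (u j)
      & A = \sum_(j < k) v j *m (u j)^T].

Definition has_nonneg_rank (R : realType) (N : nat) (A : 'M[R]_N) (k : nat) : Prop :=
  nonneg_factorization k A /\
  forall m : nat, nonneg_factorization m A -> (k <= m)%N.

Definition permanent (R : realType) (N : nat) (A : 'M[R]_N) : R :=
  \sum_(s : 'S_N) \prod_(x < N) A x (s x).

Definition doubly_stochastic (R : realType) (N : nat) : set 'M[R]_N :=
  [set Q | [/\ nonneg_mx Q,
               forall x, \sum_(y < N) Q x y = 1
             & forall y, \sum_(x < N) Q x y = 1]].

(* The library's total operations realize the usual conventions:
   lne 0 = -oo and 0 * -oo = 0, while A x y / 0 = 0.  Hence a term is 0 when
   Q x y = 0, and is -oo when A x y = 0 < Q x y; on doubly stochastic Q and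
   nonnegative A no term is +oo. *)
Definition U (R : realType) (N : nat) (A Q : 'M[R]_N) : \bar R :=
  (\sum_(x < N) \sum_(y < N) (Q x y)%:E * lne (A x y / Q x y)%:E)%E.

(* Here ln 0 is always multiplied by 0. *)
Definition V (R : realType) (N : nat) (Q : 'M[R]_N) : R :=
  \sum_(x < N) \sum_(y < N) (1 - Q x y) * ln (1 - Q x y).

(* For nonnegative A and N > 0, the two suprema below are maxima:
   doubly_stochastic is nonempty and compact, and the objectives are upper
   semicontinuous on it.  Using ereal_sup avoids a default value for
   unbounded sets. *)
Definition bethe (R : realType) (N : nat) (A : 'M[R]_N) : \bar R :=
  ereal_sup [set expeR (U A Q + (V Q)%:E)%E | Q in @doubly_stochastic R N].

Definition scaledsinkhorn (R : realType) (N : nat) (A : 'M[R]_N) : \bar R :=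
  ereal_sup [set expeR (U A Q - (N%:R)%:E)%E | Q in @doubly_stochastic R N].

(* Main.v *)
(* Take A block diagonal with k all-ones blocks whose sizes n_i differ by at most
   one; it has non-negative rank k and permanent prod_i n_i!.  If Q is doubly
   stochastic with U(A,Q) > -oo, then Q is supported on the blocks, and for a row
   q in a block of size n, Jensen's inequality gives
     sum_y (-q_y ln q_y + (1 - q_y) ln (1 - q_y)) <= ln (e_(n-1)(1 - q)),
   where e_(n-1) is the elementary symmetric polynomial; by Maclaurin's
   inequality e_(n-1)(1 - q) <= n (1 - 1/n)^(n-1) <= n exp(-1 + 1/n).  Hence
   ln bethe(A) <= sum_i (n_i ln n_i - n_i + 1), whereas
   ln n! >= n ln n - n + 1 + (ln n) / 5: each block gains a factor n_i^(1/5).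
   As the sizes are balanced, 2 sum_i ln n_i >= k ln (N/k), so c = 1/10 works.
   The scaled Sinkhorn bound follows since V(Q) >= -N. *)
Require Import Defs.
From mathcomp Require Import ring lra zify.
Set Implicit Arguments.
Unset Strict Implicit.
Unset Printing Implicit Defensive.
Import Order.TTheory GRing.Theory Num.Theory.
Local Open Scope ring_scope.

(** * Real inequalities: Maclaurin, the Bethe entropy of a row, factorials *)

Section RealInequalities.
Variable R : realType.

(** Bernoulli's inequality, in a homogeneous form that admits [a = 0]. Each induction step
    multiplies by [a + d] and drops the surplus [n.+1%:R * a ^+ n * d ^+ 2]. *)
Lemma exprD_ge_tangent (a d : R) n : 0 <= a -> 0 <= a + d ->
  a ^+ n.+1 + n.+1%:R * a ^+ n * d <= (a + d) ^+ n.+1.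
Proof.
move=> a0 ad0; elim: n => [|n IHn]; first by rewrite expr0 !expr1 !mul1r lexx.
rewrite [leRHS]exprSr.
apply: le_trans (ler_wpM2r ad0 IHn).
rewrite -subr_ge0.
suff -> : (a ^+ n.+1 + n.+1%:R * a ^+ n * d) * (a + d) -
    (a ^+ n.+2 + n.+2%:R * a ^+ n.+1 * d) = n.+1%:R * a ^+ n * d ^+ 2.
  by rewrite mulr_ge0 ?sqr_ge0 // mulr_ge0 ?exprn_ge0 ?ler0n.
by rewrite -!natr1 !exprS; ring.
Qed.

(** Induction by removing a point [a]: AM-GM bounds the product omitting [x a], the induction
    hypothesis the others. With [m] the mean of the rest and [m + d] the full mean, the resulting
    bound is exactly [n.+2] times the tangent of [t ^+ n.+1] at [m], evaluated at [m + d]. *)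
Lemma maclaurin_codim1 (T : finType) (x : T -> R) n (A : {set T}) :
  (forall y, y \in A -> 0 <= x y) -> #|A| = n.+1 ->
  \sum_(z in A) \prod_(y in A :\ z) x y <=
    n.+1%:R * ((\sum_(y in A) x y) / n.+1%:R) ^+ n.
Proof.
elim: n A => [|n IHn] A x0 cA.
  have /eqP/cards1P[a ->] := cA.
  rewrite !finset.big_set1 finset.setDv finset.big_set0 expr0 mulr1; exact: lexx.
have [a aA] : exists a, a \in A by apply/finset.set0Pn; rewrite -card_gt0 cA.
have cA' : #|A :\ a| = n.+1 by move: cA; rewrite (cardsD1 a) aA => -[].
have xa0 := x0 _ aA.
have x0' y : y \in A :\ a -> 0 <= x y by rewrite !inE => /andP[_ /x0].
rewrite (big_setD1 a) //= [X in _ + X](_ : _ =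
    x a * \sum_(z in A :\ a) \prod_(y in (A :\ a) :\ z) x y); last first.
  rewrite big_distrr /=; apply: eq_bigr => z; rewrite !inE => /andP[za zA].
  rewrite (big_setD1 a) ?inE ?aA 1?eq_sym ?za//=.
  congr (_ * _); apply: eq_bigl => y; rewrite !inE; do 2 case: eqP => //=.
rewrite (big_setD1 a aA) /=.
set s := \sum_(y in A :\ a) x y.
set m := s / n.+1%:R.
have s0 : 0 <= s by apply: sumr_ge0.
have m0 : 0 <= m by rewrite divr_ge0.
have AGM : \prod_(i in A :\ a) x i <= m ^+ n.+1.
  by move: (leif_AGM x0'); rewrite cA' => -[].
have := IHn (A :\ a) x0' cA'; rewrite -/s -/m => IH.
pose d := (x a - m) / n.+2%:R.
have n2 : n.+2%:R != 0 :> R by rewrite pnatr_eq0.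
have n1 : n.+1%:R != 0 :> R by rewrite pnatr_eq0.
have Hmd : (x a + s) / n.+2%:R = m + d.
  rewrite (_ : s = n.+1%:R * m); last by rewrite [RHS]mulrC /m divfK.
  apply: (mulIf n2); rewrite divfK // mulrDl /d divfK // -!natr1; ring.
have md0 : 0 <= m + d
  by rewrite -Hmd; apply: divr_ge0; [exact: addr_ge0|exact: ler0n].
have H := exprD_ge_tangent n m0 md0; rewrite Hmd.
apply: le_trans (lerD AGM (ler_wpM2l xa0 IH)) _.
apply: le_trans (ler_wpM2l (ler0n _ n.+2) H).
rewrite le_eqVlt; apply/orP; left; apply/eqP.
have -> : x a = m + n.+2%:R * d by rewrite /d mulrC divfK // addrC subrK.
by rewrite -!natr1 !exprS; ring.
Qed.

Lemma ln_le_tangent (a m : R) : 0 < a -> 0 < m -> ln a <= ln m + a / m - 1.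
Proof.
move=> a0 m0; have am : 0 < a / m by rewrite divr_gt0.
have aE : m * (1 + (a / m - 1)) = a by rewrite addrC subrK mulrC divfK ?gt_eqF.
rewrite -[in leLHS]aE lnM ?posrE //; last by rewrite addrC subrK.
by rewrite -addrA lerD2l le_ln1Dx //; lra.
Qed.

Lemma mul_ln_ge (w : R) : 0 <= w -> w - 1 <= w * ln w.
Proof.
rewrite le_eqVlt => /orP[/eqP<-|w0]; first by rewrite mul0r; lra.
have : ln w^-1 <= w^-1 - 1.
  have := @ln_le_tangent w^-1 1; rewrite ln1 divr1 add0r; apply => //.
  by rewrite invr_gt0.
rewrite lnV ?posrE // => /(ler_wpM2l (ltW w0)).
rewrite mulrN mulrBr mulfV ?gt_eqF //; lra.
Qed.

(** Jensen enters termwise: [ln] is replaced by its tangent at [m], the exponential of the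
    right-hand side, so points of zero mass can be treated apart. *)
Lemma bethe_entropy_le (T : finType) (p : T -> R) (A : {set T}) :
  (0 < #|A|)%N -> (forall y, y \in A -> 0 <= p y) -> \sum_(y in A) p y = 1 ->
  \sum_(y in A) (- (p y * ln (p y)) + (1 - p y) * ln (1 - p y)) <=
    ln #|A|%:R - 1 + #|A|%:R^-1.
Proof.
case cA: #|A| => [//|n] _ p0 p1.
have n1 : 0 < n.+1%:R :> R by rewrite ltr0n.
have p_le1 y : y \in A -> p y <= 1.
  move=> yA; rewrite -p1 (big_setD1 y) //= lerDl.
  by apply: sumr_ge0 => z; rewrite !inE => /andP[_ /p0].
pose P z : R := \prod_(y in A :\ z) (1 - p y).
have P0 z : z \in A -> 0 <= P z.
  move=> zA; apply: prodr_ge0 => y; rewrite !inE => /andP[_ yA].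
  by rewrite subr_ge0 p_le1.
pose m : R := expR (ln n.+1%:R - 1 + n.+1%:R^-1).
have m0 : 0 < m by apply: expR_gt0.
have Pm : \sum_(z in A) P z <= m.
  have x0 y : y \in A -> 0 <= 1 - p y by move=> yA; rewrite subr_ge0 p_le1.
  apply: le_trans (maclaurin_codim1 x0 cA) _.
  rewrite sumrB sumr_const cA p1 /m -addrA expRD lnK ?posrE //.
  rewrite ler_pM2l //.
  (* With t = -1/(n+1), the bound 1 + t <= exp t is raised to the power n; the exponent n t equals
     -1 + 1/(n+1). *)
  have -> : (n.+1%:R - 1) / n.+1%:R = 1 + - n.+1%:R^-1 :> R.
    by rewrite mulrBl mulfV ?gt_eqF // mul1r.
  have -> : -1 + n.+1%:R^-1 = - n.+1%:R^-1 *+ n :> R.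
    by rewrite -[RHS]mulr_natr -natr1; field; rewrite natr1 gt_eqF.
  rewrite -[X in expR X]mulr_natl expRM_natl.
  apply: lerXn2r; rewrite ?nnegrE ?expR_ge0 ?expR_ge1Dx //.
  by rewrite subr_ge0 invf_le1 // ler1n.
(* [1 - p y] is the mass of [A] off [y]; exchanging sums exhibits the left-hand
   side as a [p]-average of the logarithms of [P z / p z]. *)
have -> : \sum_(y in A) (- (p y * ln (p y)) + (1 - p y) * ln (1 - p y)) =
    \sum_(z in A) p z * (- ln (p z) + \sum_(y in A :\ z) ln (1 - p y)).
  under [RHS]eq_bigr do rewrite mulrDr mulrN.
  rewrite !big_split /=; congr (_ + _).
  under [RHS]eq_bigr do rewrite big_distrr /=.
  rewrite (exchange_big_dep (fun y => y \in A)) /=; last first.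
    by move=> z y _; rewrite !inE => /andP[].
  apply: eq_bigr => y yA; rewrite -big_distrl /=; congr (_ * _).
  rewrite -p1 (big_setD1 y) //= addrAC subrr add0r.
  by apply: eq_bigl => z; rewrite !inE yA andbT eq_sym andbC.
have term z : z \in A ->
    p z * (- ln (p z) + \sum_(y in A :\ z) ln (1 - p y)) <=
    p z * (ln m - 1) + P z / m.
  move=> zA; have [pz0|pz0] := leP (p z) 0.
    have -> : p z = 0 by apply: le_anti; rewrite pz0 p0.
    by rewrite !mul0r add0r divr_ge0 ?P0 // ltW.
  (* Positive mass at [z] forces [p y < 1] elsewhere, so the logarithms merge into [ln (P z)]. *)
  have q0 y : y \in A :\ z -> 0 < 1 - p y.
    move=> yAz; rewrite subr_gt0 -p1 (big_setD1 z) //= (big_setD1 y) //=.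
    rewrite addrCA ltrDl ltr_wpDr // sumr_ge0 // => w.
    by rewrite !inE => /and3P[_ _ /p0].
  have -> : \sum_(y in A :\ z) ln (1 - p y) = ln (P z).
    rewrite -[LHS]expRK expR_sum; congr ln.
    by apply: eq_bigr => y /q0 qy; rewrite lnK.
  have Pz0 : 0 < P z by apply: prodr_gt0.
  rewrite addrC -ln_div ?posrE //.
  have := @ln_le_tangent (P z / p z) m (divr_gt0 Pz0 pz0) m0.
  move=> /(ler_wpM2l (ltW pz0)) /le_trans; apply.
  rewrite le_eqVlt; apply/orP; left; apply/eqP.
  by field; rewrite ?gt_eqF.
apply: le_trans (ler_sum _ term) _.
rewrite big_split /= -big_distrl /= p1 mul1r -big_distrl /= expRK.
by rewrite -addrA gerDl addrC subr_le0 ler_pdivrMr // mul1r.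
Qed.

Lemma ln_succ_ratio_le (n : nat) :
  (n.+1%:R + 5^-1) * (ln n.+2%:R - ln n.+1%:R) <= 1 :> R.
Proof.
set N : R := n.+1%:R; have N1 : 1 <= N by rewrite ler1n.
have -> : n.+2%:R = N + 1 by rewrite natr1.
have N0 : 0 < N by lra.
rewrite -ln_div ?posrE //; last lra.
have t0 : 0 < N + 5^-1 :> R by lra.
rewrite mulrC -ler_pdivlMr // mul1r -[leRHS]expRK.
rewrite ler_ln ?posrE ?expR_gt0 ?divr_gt0 //; last lra.
set t := (N + 5^-1)^-1; have t_gt0 : 0 < t by rewrite invr_gt0.
(* The bound 1 + t <= exp t is too weak here, since t < 1/N. Its square at t/2 suffices: clearing
   denominators leaves t^2 (1 - t) / 20 >= 0. *)
have -> : t = t / 2 + t / 2 by lra.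
rewrite expRD; apply: (@le_trans _ _ ((1 + t / 2) * (1 + t / 2))).
  have tE : t * (N + 5^-1) = 1 by rewrite mulVf ?gt_eqF.
  have NE : N = t^-1 - 5^-1 by rewrite invrK addrK.
  have t1 : t <= 5 / 6 by nra.
  rewrite ler_pdivrMr // NE.
  have -> : t^-1 - 5^-1 + 1 = (1 + 4 / 5 * t) / t.
    by field; rewrite gt_eqF.
  have -> : (1 + t / 2) * (1 + t / 2) * (t^-1 - 5^-1) =
    (1 + t / 2) * (1 + t / 2) * (1 - t / 5) / t.
    by field; rewrite gt_eqF.
  rewrite ler_pM2r ?invr_gt0 //; nra.
by apply: ler_pM; rewrite ?expR_ge1Dx //; lra.
Qed.

(** Equality holds at [n = 1], and [ln_succ_ratio_le] controls the increments. The constant [1]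
    matches that of the Bethe bound for one block, leaving the gain [5^-1 * ln n]. *)
Lemma ln_factorial_ge n : (0 < n)%N ->
  (n%:R + 5^-1) * ln n%:R - n%:R + 1 <= ln n`!%:R :> R.
Proof.
case: n => [//|n] _; elim: n => [|n IHn].
  by rewrite ln1 mulr0; lra.
rewrite factS natrM lnM ?posrE ?ltr0n ?fact_gt0 //.
have := ln_succ_ratio_le n; move: IHn.
by rewrite -[n.+2%:R]natr1; lra.
Qed.

(** Jensen goes the other way; balanced sizes reverse it at the cost of the factor 2. After bounding
    [ln] of the mean by the tangent at [q], it suffices that n/q - 1 <= 2 (ln n - ln q) for n = q
    and n = q + 1, and that ln q >= 0. *)
Lemma ln_mean_le_sum_ln (k : nat) (n : 'I_k -> nat) q : (0 < k)%N -> (0 < q)%N ->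
  (forall i, q <= n i <= q.+1)%N ->
  k%:R * ln ((\sum_(i < k) n i)%:R / k%:R) <=
    2 * \sum_(i < k) ln (n i)%:R :> R.
Proof.
move=> k0 q0 nq.
have q0' : 0 < q%:R :> R by rewrite ltr0n.
have q1' : 1 <= q%:R :> R by rewrite ler1n.
have k0' : 0 < k%:R :> R by rewrite ltr0n.
have S0 : 0 < (\sum_(i < k) n i)%:R :> R.
  rewrite ltr0n; apply: leq_trans q0 _.
  rewrite (bigD1 (Ordinal k0)) //=; apply: leq_trans (leq_addr _ _).
  by case/andP: (nq (Ordinal k0)).
have lnq0 : 0 <= ln q%:R :> R by rewrite ln_ge0.
have H := ln_le_tangent (divr_gt0 S0 k0') q0'.
apply: le_trans (ler_wpM2l (ltW k0') H) _.
have term i : (ln q%:R + (n i)%:R / q%:R - 1) / 2 <= ln (n i)%:R - ln q%:R / 2 :> R.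
  have /andP[qn nq1] := nq i.
  have [->|niq] := eqVneq (n i) q; first by rewrite divff ?gt_eqF //; lra.
  have -> : n i = q.+1 by apply/eqP; rewrite eqn_leq nq1 ltn_neqAle eq_sym niq.
  have : ln q%:R <= ln q.+1%:R + q%:R / q.+1%:R - 1 :> R.
    by apply: ln_le_tangent.
  have : q.+1%:R / q%:R - 1 <= 2 * (1 - q%:R / q.+1%:R) :> R.
    rewrite -natr1 -subr_ge0.
    have -> : 2 * (1 - q%:R / (q%:R + 1)) - ((q%:R + 1) / q%:R - 1) =
       (q%:R - 1) / (q%:R * (q%:R + 1)) :> R by field; lra.
    by rewrite divr_ge0 ?mulr_ge0; lra.
  set u := _ / q%:R; set v := q%:R / _.
  move: u v => u v h1 h2; lra.
have : \sum_(i < k) (ln q%:R + (n i)%:R / q%:R - 1) / 2 <=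
    \sum_(i < k) (ln (n i)%:R - ln q%:R / 2) :> R.
  by apply: ler_sum => i _; apply: term.
rewrite -mulr_suml sumrB !big_split /= !sumr_const card_ord -mulr_suml -natr_sum.
rewrite -[ln _ *+ _]mulr_natl -[- _ *+ _]mulr_natl.
have -> : k%:R * (ln q%:R + (\sum_(i < k) n i)%:R / k%:R / q%:R - 1) =
  k%:R * ln q%:R + (\sum_(i < k) n i)%:R / q%:R - k%:R :> R.
  by field; rewrite !gt_eqF.
have := mulr_ge0 (ltW k0') lnq0; rewrite mulrN mulrA; lra.
Qed.

End RealInequalities.

(** * Block sizes and block-preserving permutations *)

Lemma count_residue (k N i : nat) : (i < k)%N ->
  (\sum_(x < N) (x %% k == i))%N = ((N + (k.-1 - i)) %/ k)%N.
Proof.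
move=> ik; have k0 : (0 < k)%N by apply: leq_trans ik.
elim: N => [|N IHN]; first by rewrite big_ord0 add0n divn_small //; lia.
rewrite big_ord_recr /= IHN addSn divnS // addnC; congr (nat_of_bool _ + _)%N.
(* The offset [k.-1 - i] makes the quotient jump exactly when [N] is congruent to [i] modulo [k]. *)
have -> : (N + (k.-1 - i)).+1 = (N + k - i)%N by lia.
rewrite -eqn_mod_dvd; last lia.
by rewrite modnDr (modn_small ik).
Qed.

Section BlockPartition.
Variables (N k : nat) (b : 'I_N -> 'I_k).

Definition block (i : 'I_k) : {set 'I_N} := [set x | b x == i].

Lemma sum_card_block : (\sum_(i < k) #|block i|)%N = N.
Proof.
rewrite -[RHS]card_ord -sum1_card (partition_big b xpredT) //=.
by apply: eq_bigr => i _; rewrite sum1dep_card.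
Qed.

Definition glue (f : {ffun 'I_k -> 'S_N}) (x : 'I_N) : 'I_N := f (b x) x.

Lemma glue_block (f : {ffun 'I_k -> 'S_N}) x :
  (forall i, perm_on (block i) (f i)) -> b (glue f x) = b x.
Proof.
move=> fP; apply/eqP; have := perm_closed x (fP (b x)).
by rewrite !inE eqxx.
Qed.

(** Permutations [f i], each supported on its block, glue to one preserving [b]. Gluing is
    injective: [f i] is recovered on block [i] and is the identity off it. *)
Lemma prod_factorial_le_card_block_perm :
  (\prod_(i < k) (#|block i|)`! <= #|[set s : 'S_N | [forall x, b (s x) == b x]]|)%N.
Proof.
pose F := family (fun i : 'I_k => [pred s | perm_on (block i) s]).
have cF : #|F| = (\prod_(i < k) (#|block i|)`!)%N.
  rewrite card_family foldrE big_map big_enum /=.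
  by apply: eq_bigr => i _; rewrite -card_perm; apply: eq_card.
have FP f : f \in F -> forall i, perm_on (block i) (f i).
  by move=> /familyP fF i; have := fF i; rewrite inE.
have glue_inj f : f \in F -> injective (glue f).
  move=> /FP fP x y e; have e' := congr1 b e.
  rewrite !glue_block // in e'.
  by move: e; rewrite /glue e'; apply: perm_inj.
(* Injectivity of [glue f] is known only on [F], so the permutation is obtained by [pick]; the
   default is never reached on [F]. *)
pose G (f : {ffun 'I_k -> 'S_N}) : 'S_N :=
  odflt 1%g [pick s : {perm 'I_N} | [forall x, s x == glue f x]].
have GE f x : f \in F -> G f x = f (b x) x.
  move=> fF; rewrite /G; case: pickP => [s /forallP/(_ x)/eqP //|noG].
  have /forallP[y] := noG (perm (glue_inj f fF)).
  by rewrite permE.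
rewrite -cF -(@card_in_imset _ _ G); last first.
  move=> f g fF gF e; apply/ffunP => i; apply/permP => x.
  have [bx|bx] := eqVneq (b x) i.
    by rewrite -bx -!GE // e.
  by rewrite !(out_perm (FP _ _ i)) ?inE.
apply: subset_leq_card; apply/fintype.subsetP => s /imsetP[f fF ->].
by rewrite inE; apply/forallP => x; rewrite GE //; apply/eqP/glue_block/FP.
Qed.

End BlockPartition.

(** * Permanent and non-negative rank of the block matrix *)

Section BlockMatrix.
Variables (R : realType) (N k : nat) (b : 'I_N -> 'I_k).

Definition block_indicator_mx : 'M[R]_N := \matrix_(x, y) (b x == b y)%:R.

Lemma permanent_block_ge :
  (\prod_(i < k) (#|block b i|)`!)%:R <= permanent block_indicator_mx.
Proof.
have -> : permanent block_indicator_mx =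
    #|[set s : 'S_N | [forall x, b (s x) == b x]]|%:R.
  rewrite /permanent -sum1dep_card natr_sum [RHS]big_mkcond /=.
  apply: eq_bigr => s _; case: ifPn => [/forallP bs|/forallPn[x bs]].
    by rewrite big1 // => x _; rewrite mxE eq_sym bs.
  by apply/eqP/prodf_eq0; exists x; rewrite // mxE [b x == _]eq_sym (negbTE bs).
by rewrite ler_nat prod_factorial_le_card_block_perm.
Qed.

(** The block indicator vectors give a factorization. Conversely, restricting any factorization to
    the representatives [r i] factors the identity of size [k] through dimension [m], so ordinary
    rank gives [k <= m]. *)
Lemma block_indicator_nonneg_rank (r : 'I_k -> 'I_N) :
  cancel r b -> has_nonneg_rank block_indicator_mx k.
Proof.
move=> rK; split.
  pose v (j : 'I_k) : 'cV[R]_N := \col_x (b x == j)%:R.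
  exists v, v; split; try by move=> j x y; rewrite mxE ler0n.
  apply/matrixP => x y; rewrite summxE mxE (bigD1 (b x)) //= big1 ?addr0.
    by rewrite !mxE big_ord1 !mxE eqxx mul1r eq_sym.
  by move=> j jx; rewrite !mxE big_ord1 !mxE eq_sym (negbTE jx) mul0r.
move=> m [v [u [_ _ E]]].
pose V : 'M[R]_(k, m) := \matrix_(i, j) v j (r i) 0.
pose W : 'M[R]_(m, k) := \matrix_(j, i) u j (r i) 0.
have VW : V *m W = 1%:M.
  apply/matrixP => i j; have /matrixP/(_ (r i) (r j)) := E.
  rewrite !mxE !rK => ->; rewrite summxE; apply: eq_bigr => l _.
  by rewrite !mxE big_ord1 !mxE.
by have := mulmx_max_rank V W; rewrite VW mxrank1.
Qed.

End BlockMatrix.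

(** * Bounds on the scaled Sinkhorn and Bethe values *)

Lemma scaledsinkhorn_le_bethe (R : realType) (N : nat) (A : 'M[R]_N) :
  (scaledsinkhorn A <= bethe A)%E.
Proof.
apply: ge_ereal_sup => _ [Q QDS <-].
apply: le_trans (_ : expeR (U A Q + (V Q)%:E) <= _)%E; last first.
  by apply: ereal_sup_ubound; exists Q.
rewrite lee_expeR -EFinN; apply: leeD2l; rewrite lee_fin.
have [Q0 Qr _] := QDS.
(* The entries of [Q] sum to [N], which reduces the claim to (1 - q) ln (1 - q) >= -q for each
   entry. *)
have -> : - N%:R = \sum_(x < N) \sum_(y < N) - Q x y.
  under eq_bigr do rewrite sumrN Qr.
  by rewrite sumr_const card_ord mulNrn.
apply: ler_sum => x _; apply: ler_sum => y _.
have Q1 : Q x y <= 1.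
  by rewrite -(Qr x) (bigD1 y) //= lerDl sumr_ge0.
have := @mul_ln_ge R (1 - Q x y); rewrite subr_ge0 => /(_ Q1).
by rewrite addrC addKr.
Qed.

Section BetheBlock.
Variables (R : realType) (N k : nat) (b : 'I_N -> 'I_k).
Let A : 'M[R]_N := block_indicator_mx R b.

(** Mass outside the block of [x] makes the first sum [-oo] while the second stays finite; otherwise
    only the block contributes and [bethe_entropy_le] applies. *)
Lemma bethe_row_block_le (q : 'I_N -> R) (x : 'I_N) :
  (forall y, 0 <= q y) -> \sum_(y < N) q y = 1 ->
  (\sum_(y < N) (q y)%:E * lne (A x y / q y)%:E +
     (\sum_(y < N) (1 - q y) * ln (1 - q y))%:E <=
   (ln #|block b (b x)|%:R - 1 + #|block b (b x)|%:R^-1)%:E)%E.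
Proof.
move=> q0 q1; set B := block b (b x).
have [/existsP[y /andP[yB qy]]|/existsPn qB] :=
    boolP [exists y, (y \notin B) && (q y != 0)].
  suff -> : (\sum_(y < N) (q y)%:E * lne (A x y / q y)%:E)%E = -oo%E.
    by rewrite addNye leNye.
  apply/esum_eqNyP; exists y; split; rewrite ?mem_index_enum //.
  rewrite !mxE; rewrite !inE eq_sym in yB.
  rewrite (negbTE yB) mul0r le0_lneNy // gt0_muleNy //.
  by rewrite lte_fin lt_def qy q0.
have {}qB y : y \notin B -> q y = 0.
  by move=> yB; have := qB y; rewrite yB /= negbK => /eqP.
have BE (F : 'I_N -> R) : (forall y, y \notin B -> F y = 0) ->
    \sum_(y < N) F y = \sum_(y in B) F y.
  move=> F0; rewrite [RHS]big_mkcond; apply: eq_bigr => y _.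
  by case: ifPn => // /F0.
have -> : (\sum_(y < N) (q y)%:E * lne (A x y / q y)%:E)%E =
    (\sum_(y < N) - (q y * ln (q y)))%:E.
  rewrite -sumEFin; apply: eq_bigr => y _.
  have [->|qy] := eqVneq (q y) 0; first by rewrite mul0e mul0r oppr0.
  have qy0 : 0 < q y by rewrite lt_def qy q0.
  have : y \in B by apply: contraNT qy => /qB ->.
  rewrite inE mxE eq_sym => ->.
  by rewrite mul1r lne_EFin ?invr_gt0 // lnV ?posrE // -EFinM mulrN.
rewrite -EFinD lee_fin -big_split /= BE; last first.
  by move=> y /qB ->; rewrite mul0r !oppr0 !addr0 ln1 mulr0 addr0.
apply: bethe_entropy_le => //; last by rewrite -BE.
by apply/card_gt0P; exists x; rewrite inE.
Qed.

(** The n rows of a block of size n each contribute at most ln n - 1 + 1/n, hence n ln n - n + 1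
    together. *)
Lemma bethe_block_le : (forall i, 0 < #|block b i|)%N ->
  (bethe A <= (expR (\sum_(i < k) (#|block b i|%:R * ln #|block b i|%:R -
                                    #|block b i|%:R + 1)))%:E)%E.
Proof.
move=> b_gt0; apply: ge_ereal_sup => _ [Q [Q0 Qr _] <-].
rewrite -[leRHS]/(expeR _%:E) lee_expeR.
have -> : \sum_(i < k) (#|block b i|%:R * ln #|block b i|%:R -
      #|block b i|%:R + 1) =
    \sum_(x < N) (ln #|block b (b x)|%:R - 1 + #|block b (b x)|%:R^-1) :> R.
  rewrite [RHS](partition_big b xpredT) //=; apply: eq_bigr => i _.
  rewrite (eq_bigr (fun=> ln #|block b i|%:R - 1 + #|block b i|%:R^-1)).
    rewrite sumr_const -[RHS]mulr_natl.
    have -> : #|[pred x | b x == i]| = #|block b i|.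
      by apply: eq_card => x; rewrite !inE.
    rewrite mulrDr mulfV; first ring.
    by rewrite pnatr_eq0 -lt0n.
  by move=> x /eqP ->.
rewrite /U /V -sumEFin -big_split -sumEFin.
by apply: lee_sum => x _; apply: bethe_row_block_le.
Qed.

End BetheBlock.

(** * Assembly, with residue classes as blocks *)

Theorem theorem3p3 (R : realType) :
  exists2 c : R, 0 < c &
    forall k N : nat, (0 < k)%N -> (k <= N)%N ->
      exists A : 'M[R]_N,
        [/\ nonneg_mx A,
            has_nonneg_rank A k,
            0 < permanent A,
            ((expR (c * k%:R * ln (N%:R / k%:R)))%:E * bethe A
               <= (permanent A)%:E)%E
          & ((expR (c * k%:R * ln (N%:R / k%:R)))%:E * scaledsinkhorn A
               <= (permanent A)%:E)%E].
Proof.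
exists 10^-1; first by rewrite invr_gt0.
move=> k N k0 kN.
(* Residues modulo [k] give balanced blocks; as [k <= N], the first [k] indices represent them. *)
pose b (x : 'I_N) : 'I_k := Ordinal (ltn_pmod x k0).
pose r (i : 'I_k) : 'I_N := widen_ord kN i.
have rK : cancel r b by move=> i; apply: val_inj; rewrite /= modn_small.
pose n i := #|block b i|.
have nE i : n i = ((N + (k.-1 - i)) %/ k)%N.
  rewrite -(count_residue N (ltn_ord i)) /n /block -sum1dep_card big_mkcond /=.
  by apply: eq_bigr => x _; rewrite -val_eqE /=; case: eqP.
have q0 : (0 < N %/ k)%N by rewrite divn_gt0.
have nq i : (N %/ k <= n i <= (N %/ k).+1)%N.
  have -> : (N %/ k).+1 = ((N + k) %/ k)%N.
    by rewrite divnDr ?dvdnn // divnn k0 addn1.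
  rewrite nE !leq_div2r ?leq_addr // leq_add2l.
  by apply: leq_trans (leq_subr _ _) (leq_pred _).
have n0 i : (0 < n i)%N by apply: leq_trans q0 _; case/andP: (nq i).
have permA := permanent_block_ge R b.
have betheA := @bethe_block_le R N k b n0.
set A := block_indicator_mx R b in permA betheA *.
have main : ((expR (10^-1 * k%:R * ln (N%:R / k%:R)))%:E * bethe A
    <= (permanent A)%:E)%E.
  apply: le_trans (lee_wpmul2l _ betheA) _; first by rewrite lee_fin expR_ge0.
  rewrite -EFinM lee_fin; apply: le_trans permA.
  rewrite -expRD natr_prod.
  rewrite [leRHS](eq_bigr (fun i => expR (ln (n i)`!%:R))); last first.
    by move=> i _; rewrite lnK ?posrE ?ltr0n ?fact_gt0.
  rewrite -expR_sum ler_expR.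
  have := ln_mean_le_sum_ln R k0 q0 nq; rewrite sum_card_block => mean.
  (* The constant 1/10 is the factorial gain 1/5 divided by the factor 2 lost in [mean]. *)
  apply: le_trans (_ : 5^-1 * \sum_(i < k) ln (n i)%:R +
    \sum_(i < k) ((n i)%:R * ln (n i)%:R - (n i)%:R + 1) <= _).
    rewrite lerD2r; lra.
  rewrite mulr_sumr -big_split /=; apply: ler_sum => i _.
  apply: le_trans (ln_factorial_ge R (n0 i)); lra.
exists A; split=> //.
- by move=> x y; rewrite mxE ler0n.
- exact: block_indicator_nonneg_rank rK.
- by apply: lt_le_trans permA; rewrite ltr0n prodn_gt0 // => i; rewrite fact_gt0.
- apply: le_trans main; apply: lee_wpmul2l; first by rewrite lee_fin expR_ge0.
  exact: scaledsinkhorn_le_bethe.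
Qed.
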